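(* Let $L$ be a bounded lattice, let $X_L = J^\infty(L^\delta)$ and $Y_L = M^\infty(L^\delta)$. For $a\in L$ put $\hat a = \{x \in X_L \mid x \leq a\}$ and $\check a = \{y \in Y_L \mid a \leq y\}$, and let $\hat L = \{\hat a \mid a \in L\}$, $\check L = \{\check a \mid a \in L\}$. Then the bicompletion of the quasi-uniform Pervin space $(X_L, \mathcal{U}_{\hat L})$ is the dual space of the distributive $\wedge$-envelope $D^\wedge(L)$ of $L$, i.e., with its induced topology it is the Stone dual space of $D^\wedge(L)$. Order dually, the bicompletion of the quasi-uniform Pervin space $(Y_L,\mathcal{U}_{\check L})$ is the dual space of the distributive $\vee$-envelope $D^\vee(L)$ of $L$, i.e., with its induced topology it is the Stone dual space of the order dual $D^\vee(L)^{\mathrm{op}}$.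
   Context: All lattices are bounded, homomorphisms preserve $0,1$, finite meets/joins include empty ones. Canonical extension: a canonical extension of $L$ is a lattice embedding $e : L \to C$ into a complete lattice such that (1) every $u \in C$ satisfies $u=\bigvee\{\bigwedge e[S] \mid S \subseteq L, \bigwedge e[S]\leq u\} = \bigwedge\{\bigvee e[T] \mid T\subseteq L, u \leq \bigvee e[T]\}$, and (2) for $S,T \subseteq L$, if $\bigwedge e[S]\leq\bigvee e[T]$ then $\bigwedge S' \leq \bigvee T'$ in $L$ for some finite $S' \subseteq S$, $T'\subseteq T$. It exists and is unique up to isomorphism fixing $L$; it is denoted $L^\delta$ and $L$ is regarded as a sublattice of it. $J^\infty(L^\delta)$ (resp. $M^\infty(L^\delta)$) is the set of completely join-irreducible (resp. completely meet-irreducible) elements: those $x$ such that $x=\bigvee S$ (resp. $x=\bigwedge S$) implies $x \in S$. Distributive envelopes: a finite $M \subseteq L$ is join-admissible if $a\wedge\bigvee M = \bigvee_{m \in M}(a \wedge m)$ for all $a\in L$; a function $f$ on $L$ preserves admissible joins if $f(\bigvee M)=\bigvee_{m \in M} f(m)$ for all finite join-admissible $M\subseteq L$. The distributive $\wedge$-envelope of $L$ is a distributive lattice $D^\wedge(L)$ with an embedding $\eta : L \to D^\wedge(L)$ preserving finite meets and admissible joins, such that every function $f : L \to D$ into a distributive lattice $D$ preserving finite meets and admissible joins factors as $f = \hat f\circ \eta$ for a unique lattice homomorphism $\hat f : D^\wedge(L) \to D$ (it exists and is unique up to isomorphism). The distributive $\vee$-envelope $D^\vee(L)$ is defined order dually,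 i.e. $D^\vee(L) = (D^\wedge(L^{\mathrm{op}}))^{\mathrm{op}}$. Quasi-uniformities: for $A \subseteq X$ put $U_A = \{(x,y) \in X\times X \mid x\in A \Rightarrow y\in A\}$. For $\mathcal K\subseteq\mathcal P(X)$, the Pervin space $(X,\mathcal U_{\mathcal K})$ is the quasi-uniform space whose quasi-uniformity is the filter on $X\times X$ generated by the sets $U_A$, $A\in\mathcal K$. The topology induced by a quasi-uniformity $\mathcal U$ has as neighbourhoods of $x$ the sets $\{y \mid (x,y)\in U\}$, $U \in \mathcal U$. The symmetrization $\mathcal U^s$ is the filter generated by $\mathcal U\cup\mathcal U^{-1}$; $(X,\mathcal U)$ is bicomplete if the uniform space $(X,\mathcal U^s)$ is complete (every Cauchy filter converges). The bicompletion of $(X,\mathcal U)$ is the ($T_0$) bicomplete quasi-uniform space $(\widetilde X,\widetilde{\mathcal U})$ with uniformly continuous map $X\to\widetilde X$ which is the reflection of $(X,\mathcal U)$ in ($T_0$) bicomplete quasi-uniform spaces with uniformly continuous maps. The Stone dual space of a distributive lattice $D$ is the set of prime filters of $D$ with the topology having as a basis the sets $\{p \mid d \in p\}$, $d \in D$. *)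

(* Defs.v *)
From HB Require Import structures.
From mathcomp Require Import all_boot all_order finmap.
From mathcomp Require Import boolp classical_sets filter topology.

Set Implicit Arguments.
Unset Strict Implicit.
Unset Printing Implicit Defensive.

Import Order.TTheory.

Local Open Scope classical_set_scope.
Local Open Scope order_scope.

(* The library's {tblmorphism L -> M} only records the preservation of \bot
   and \top, not that of binary meets and joins. *)
Definition lattice_hom dL (L : tbLatticeType dL) dM (M : tbLatticeType dM)
    (f : L -> M) : Prop :=
  [/\ Order.meet_morphism f, Order.join_morphism f,
      f \bot = \bot & f \top = \top].

Definition complete_lattice dC (C : tbLatticeType dC) : Prop :=
  forall S : set C, supremums S !=set0 /\ infimums S !=set0.

(* In a complete lattice these are the join and the meet of an arbitrary
   subset, the empty one included. *)
Definition bigjoin dC (C : tbLatticeType dC) (S : set C) : C :=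
  supremum \bot S.
Definition bigmeet dC (C : tbLatticeType dC) (S : set C) : C :=
  infimum \top S.

Definition canonical_extension dL (L : tbLatticeType dL)
    dC (C : tbLatticeType dC) (e : L -> C) : Prop :=
  [/\ complete_lattice C,
      lattice_hom e,
      injective e,
      forall u : C,
        u = bigjoin [set bigmeet (e @` S) | S in
                      [set S : set L | bigmeet (e @` S) <= u]] /\
        u = bigmeet [set bigjoin (e @` T) | T in
                      [set T : set L | u <= bigjoin (e @` T)]] &
      forall S T : set L, bigmeet (e @` S) <= bigjoin (e @` T) ->
        exists S' T' : {fset L},
          [/\ [set` S'] `<=` S, [set` T'] `<=` T &
              \meet_(s <- S') s <= \join_(t <- T') t]].

Definition completely_join_irreducible dC (C : tbLatticeType dC) : set C :=
  [set x | forall S : set C, x = bigjoin S -> S x].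
Definition completely_meet_irreducible dC (C : tbLatticeType dC) : set C :=
  [set y | forall S : set C, y = bigmeet S -> S y].

Definition join_admissible dL (L : tbLatticeType dL) (M : {fset L}) : Prop :=
  forall a : L, a `&` (\join_(m <- M) m) = \join_(m <- M) (a `&` m).

Definition preserves_finite_meets dL (L : tbLatticeType dL)
    dD (D : tbLatticeType dD) (f : L -> D) : Prop :=
  forall M : {fset L}, f (\meet_(m <- M) m) = \meet_(m <- M) f m.

Definition preserves_admissible_joins dL (L : tbLatticeType dL)
    dD (D : tbLatticeType dD) (f : L -> D) : Prop :=
  forall M : {fset L}, join_admissible M ->
    f (\join_(m <- M) m) = \join_(m <- M) f m.

Definition wedge_envelope dL (L : tbLatticeType dL)
    dD (D : tbDistrLatticeType dD) (eta : L -> D) : Prop :=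
  [/\ injective eta,
      preserves_finite_meets eta,
      preserves_admissible_joins eta &
      forall dE (E : tbDistrLatticeType dE) (f : L -> E),
        preserves_finite_meets f -> preserves_admissible_joins f ->
        exists! g : D -> E, lattice_hom g /\ f = g \o eta].

(* The carriers of L^d and D^d are those of L and D. *)
Definition vee_envelope dL (L : tbLatticeType dL)
    dD (D : tbDistrLatticeType dD) (eta : L -> D) : Prop :=
  @wedge_envelope _ (L^d)%type _ (D^d)%type eta.

Local Open Scope relation_scope.

(* The entourages of the library's isUniform, without symmetry. *)
HB.mixin Record isQuasiUniform X of Choice X := {
  qentourage : set_system (X * X);
  qentourage_filter : Filter qentourage;
  qentourage_diagonal : forall A, qentourage A -> diagonal `<=` A;
  qentourage_split_ex :
    forall A, qentourage A -> exists2 B, qentourage B & B \; B `<=` A;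
}.

#[short(type="quasiUniformType")]
HB.structure Definition QuasiUniform := {X of Choice X & isQuasiUniform X}.

Definition qunif_continuous (X Y : quasiUniformType) (f : X -> Y) : Prop :=
  (fun xy => (f xy.1, f xy.2)) @ (@qentourage X) --> (@qentourage Y).

(* Alias of X carrying the induced topology: the library's nbhs_ makes the
   sections {y | (x, y) \in U} a base of neighbourhoods of x. *)
Definition qtopology (X : quasiUniformType) : Type := X.

Section InducedTopology.
Variable X : quasiUniformType.

HB.instance Definition _ := Choice.on (qtopology X).
HB.instance Definition _ :=
  hasNbhs.Build (qtopology X) (nbhs_ (@qentourage X)).

Let qnbhs_filter (p : qtopology X) : ProperFilter (nbhs p).
Proof.
apply: filter_from_proper; last first.
  by move=> A entA; exists p; apply/mem_set; apply: qentourage_diagonal entA _ _.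
apply: filter_from_filter.
  by exists setT; exact: (@filterT _ _ (@qentourage_filter X)).
move=> A B entA entB; exists (A `&` B); last by rewrite xsectionI.
exact: (@filterI _ _ (@qentourage_filter X)).
Qed.

Let qnbhs_singleton (p : qtopology X) A : nbhs p A -> A p.
Proof.
move=> [B entB sBpA].
by apply/sBpA/mem_set; exact: qentourage_diagonal entB _ _.
Qed.

Let qnbhs_nbhs (p : qtopology X) A : nbhs p A -> nbhs p (nbhs^~ A).
Proof.
move=> [B entB sBpA]; have [C entC sC2B] := qentourage_split_ex _ entB.
exists C => // q Cpq; exists C => // r Cqr.
by apply/sBpA/mem_set/sC2B; exists q; exact/set_mem.
Qed.

HB.instance Definition _ := Nbhs_isNbhsTopological.Build (qtopology X)
  qnbhs_filter qnbhs_singleton qnbhs_nbhs.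

End InducedTopology.

(* Alias of X carrying the uniformity generated by U and U^-1. *)
Definition symmetrization (X : quasiUniformType) : Type := X.

Definition sym_entourage (X : quasiUniformType) : set_system (X * X) :=
  smallest Filter
    ((@qentourage X) `|` [set A^-1 | A in @qentourage X])%classic.

Section Symmetrization.
Variable X : quasiUniformType.
Local Notation ent := (@sym_entourage X).

Let sym_gen A : qentourage A -> ent A /\ ent A^-1.
Proof.
by move=> qA; split; apply: sub_gen_smallest; [left|right; exists A].
Qed.

Let sym_ind (M : set_system (X * X)) : Filter M ->
  (forall A, qentourage A -> M A /\ M A^-1) -> ent `<=` M.
Proof.
move=> FM MA A; apply; split=> // B [/MA[]//|[B' /MA[_ ?] <-//]].
Qed.

Let sym_filter : Filter ent.
Proof. exact: smallest_filter_filter. Qed.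

Let sym_diagonal A : ent A -> diagonal `<=` A.
Proof.
apply: (sym_ind (M := globally diagonal)).
move=> B /(qentourage_diagonal _) dB; split=> //= -[x y] /= xy.
by apply: dB; rewrite /diagonal/= in xy *.
Qed.

Let sym_inv A : ent A -> ent A^-1.
Proof.
apply: (sym_ind (M := [set A | ent A^-1])).
  split=> /=.
  - exact: filterT.
  - by move=> P Q eP eQ; exact: (@filterI _ _ sym_filter _ _ eP eQ).
  - by move=> P Q PQ; apply: (@filterS _ _ sym_filter) => -[x y]; exact: PQ.
move=> B /sym_gen[eB eBV]; split=> //=.
by have -> : (B^-1)^-1 = B by apply/seteqP; split=> -[].
Qed.

Let sym_split_ex A : ent A -> exists2 B, ent B & B \; B `<=` A.
Proof.
apply: (sym_ind (M := [set A | exists2 B, ent B & B \; B `<=` A])).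
  split=> /=.
  - by exists setT => //; exact: (@filterT _ _ sym_filter).
  - move=> P Q [B eB BP] [C eC CQ]; exists (B `&` C); first exact: (@filterI _ _ sym_filter).
    move=> [x z] [y [/= Bxy Cxy] [/= Byz Cyz]]; split.
      by apply: BP; exists y.
    by apply: CQ; exists y.
  - by move=> P Q PQ [B eB BP]; exists B => //; exact: subset_trans PQ.
move=> B /(qentourage_split_ex _)[C /sym_gen[eC eCV] CB]; split; first by exists C.
exists C^-1 => // -[x z] [y /= Cyx Czy].
by apply: CB; exists y.
Qed.

HB.instance Definition _ := Choice.on (symmetrization X).
HB.instance Definition _ := isUniform.Build (symmetrization X)
  sym_filter sym_diagonal sym_inv sym_split_ex.

End Symmetrization.

Definition bicomplete (X : quasiUniformType) : Prop :=
  forall F : set_system (symmetrization X), ProperFilter F -> cauchy F ->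
    exists x : symmetrization X, F --> x.

Definition is_bicompletion (X Xt : quasiUniformType) (i : X -> Xt) : Prop :=
  [/\ kolmogorov_space (qtopology Xt),
      bicomplete Xt,
      qunif_continuous i &
      forall (Z : quasiUniformType) (f : X -> Z),
        kolmogorov_space (qtopology Z) -> bicomplete Z -> qunif_continuous f ->
        exists! g : Xt -> Z, qunif_continuous g /\ f = g \o i].

Definition pervin_rel (X : Type) (A : set X) : set (X * X) :=
  [set xy | A xy.1 -> A xy.2].

Definition pervin (X : choiceType) (K : set_system X) : Type := X.

Section Pervin.
Variables (X : choiceType) (K : set_system X).

Definition pervin_entourage : set_system (X * X) :=
  smallest Filter [set pervin_rel A | A in K].

Let pervin_ind (M : set_system (X * X)) : Filter M ->
  (forall A, K A -> M (pervin_rel A)) -> pervin_entourage `<=` M.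
Proof. by move=> FM MA A; apply; split=> // _ [B /MA ? <-]. Qed.

Let pervin_filter : Filter pervin_entourage.
Proof. exact: smallest_filter_filter. Qed.

Let pervin_diagonal A : pervin_entourage A -> diagonal `<=` A.
Proof.
apply: (pervin_ind (M := globally diagonal)).
by move=> B KB [x y] /= xy; rewrite /diagonal/= in xy; rewrite /pervin_rel/= xy.
Qed.

Let pervin_split_ex A :
  pervin_entourage A -> exists2 B, pervin_entourage B & B \; B `<=` A.
Proof.
apply: (pervin_ind (M := [set A | exists2 B, pervin_entourage B & B \; B `<=` A])).
  split=> /=.
  - by exists setT => //; exact: (@filterT _ _ pervin_filter).
  - move=> P Q [B eB BP] [C eC CQ]; exists (B `&` C); first exact: (@filterI _ _ pervin_filter).
    move=> [x z] [y [/= Bxy Cxy] [/= Byz Cyz]]; split.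
      by apply: BP; exists y.
    by apply: CQ; exists y.
  - by move=> P Q PQ [B eB BP]; exists B => //; exact: subset_trans PQ.
move=> B KB; exists (pervin_rel B).
  by apply: sub_gen_smallest; exists B.
by move=> [x z] [y /= Bxy Byz] /Bxy /Byz.
Qed.

HB.instance Definition _ := Choice.on (pervin K).
HB.instance Definition _ := isQuasiUniform.Build (pervin K)
  pervin_filter pervin_diagonal pervin_split_ex.

End Pervin.

Definition prime_filter dD (D : tbDistrLatticeType dD) : set (set D) :=
  [set p | [/\ p \top /\ ~ p \bot,
               forall a b, a <= b -> p a -> p b,
               forall a b, p a -> p b -> p (a `&` b) &
               forall a b, p (a `|` b) -> p a \/ p b]].

Definition stone_dual dD (D : tbDistrLatticeType dD) : Type :=
  set_type (@prime_filter dD D).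

(* The Stone topology, with the sets stone_basic d as a base, is declared as
   an instance below. *)
Definition stone_basic dD (D : tbDistrLatticeType dD) (d : D) :
    set (stone_dual D) :=
  [set p | sval p d].

Section StoneTopology.
Variables (dD : Order.disp_t) (D : tbDistrLatticeType dD).

HB.instance Definition _ := Choice.on (stone_dual D).

Let stone_cover :
  \bigcup_(A in range (@stone_basic dD D)) A = [set: stone_dual D].
Proof.
apply/seteqP; split=> // p _; exists (stone_basic \top); first by exists \top.
by case: (set_mem (svalP p)) => -[].
Qed.

Let stone_join (A B : set (stone_dual D)) (p : stone_dual D) :
  range (@stone_basic dD D) A -> range (@stone_basic dD D) B -> A p -> B p ->
  exists C, [/\ range (@stone_basic dD D) C, C p & C `<=` A `&` B].
Proof.
move=> [a _ <-] [b _ <-] pa pb; exists (stone_basic (a `&` b)); split.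
- by exists (a `&` b).
- by case: (set_mem (svalP p)) => _ _ + _; apply.
- move=> q qab; case: (set_mem (svalP q)) => _ up _ _.
  by split; apply: up qab; [exact: leIl|exact: leIr].
Qed.

HB.instance Definition _ := isBaseTopological.Build (stone_dual D)
  stone_cover stone_join.

End StoneTopology.

Definition homeomorphic (S T : topologicalType) : Prop :=
  exists (f : S -> T) (g : T -> S),
    [/\ cancel f g, cancel g f, continuous f & continuous g].

(* The bicompletion is only determined up to isomorphism: there is one, and
   the space underlying any of them is homeomorphic to T. *)
Definition bicompletion_homeomorphic_to (X : quasiUniformType)
    (T : topologicalType) : Prop :=
  (exists (Xt : quasiUniformType) (i : X -> Xt), is_bicompletion i) /\
  (forall (Xt : quasiUniformType) (i : X -> Xt), is_bicompletion i ->
     homeomorphic (qtopology Xt) T).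

Section PervinSpacesOfLattice.
Variables (dL : Order.disp_t) (L : tbLatticeType dL).
Variables (dC : Order.disp_t) (C : tbLatticeType dC) (e : L -> C).

Definition hat (a : L) : set (set_type (@completely_join_irreducible dC C)) :=
  [set x | sval x <= e a].

Definition check (a : L) : set (set_type (@completely_meet_irreducible dC C)) :=
  [set y | e a <= sval y].

Definition hat_pervin : quasiUniformType := pervin (range hat).
Definition check_pervin : quasiUniformType := pervin (range check).

End PervinSpacesOfLattice.

(* Main.v *)
Require Import Defs.
From HB Require Import structures.
From mathcomp Require Import all_boot all_order finmap.
From mathcomp Require Import boolp classical_sets filter topology.

(** The theorem has an order-theoretic half and a topological half.

    Order theory.  Write X for the set of completely join-irreducible elements
    of the canonical extension.  By compactness and Zorn's lemma X is
    join-dense ([join_irreducible_dense]), and its elements are prime with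
    respect to admissible joins ([join_irreducible_admissible]).  So the hat map
    from L to the subsets of X preserves finite meets and admissible joins, and
    conversely, if the hat of a is covered by the hats of finitely many b, then
    a is the admissible join of the elements a /\ b ([hat_cover]).  This says
    that the relations between finite unions of hats are exactly those which
    admissible joins force in any envelope.  Hence the envelope is isomorphic to
    the lattice of finite unions of hats ([envelope_representation]).

    Topology.  Let a lattice D be identified with the finite unions of sets from
    a family K of subsets of X.  A point of X gives the prime filter of those
    elements of D that contain it.  The Stone dual of D, with the Pervin
    quasi-uniformity of its basic open sets, is T0 and bicomplete: a Cauchy
    filter for the symmetrization decides every basic set, hence converges to
    the prime filter of those that it accepts ([stone_pervin_bicomplete]).  The
    Pervin quasi-uniformity of K is induced from it, and X is dense for the
    symmetrization because distinct elements of D are distinct sets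
    ([point_filter_dense]).  These properties characterize the bicompletion
    ([dense_initial_is_bicompletion]), and two bicompletions are homeomorphic.

    The statement on completely meet-irreducible elements is the first one for
    the order duals of L, of its canonical extension and of the envelope. *)

Set Implicit Arguments.
Unset Strict Implicit.
Unset Printing Implicit Defensive.

Import Order.TTheory.

Local Open Scope classical_set_scope.
Local Open Scope order_scope.
Local Open Scope relation_scope.

(** * Quasi-uniform spaces and their bicompletions *)

Section QuasiUniform.
Implicit Types X Y Z W : quasiUniformType.

Lemma sym_entourage_ind X (M : set_system (X * X)) : Filter M ->
  (forall A, qentourage A -> M A /\ M A^-1) -> @sym_entourage X `<=` M.
Proof.
by move=> FM MA A; apply; split=> // B [/MA[]//|[B' /MA[_ ?] <-//]].
Qed.

Lemma qentourage_sym X (A : set (X * X)) : qentourage A ->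
  sym_entourage A /\ sym_entourage A^-1.
Proof.
by move=> qA; split; apply: sub_gen_smallest; [left|right; exists A].
Qed.

Lemma sym_entourage_filter X : Filter (@sym_entourage X).
Proof. exact: smallest_filter_filter. Qed.
#[local] Existing Instance sym_entourage_filter.

Lemma sym_entourage_inv X (A : set (X * X)) :
  sym_entourage A -> sym_entourage A^-1.
Proof. exact: (@entourage_inv (symmetrization X)). Qed.

Lemma sym_entourage_half X (A : set (X * X)) : sym_entourage A ->
  exists B, [/\ sym_entourage B, forall x y, B (x, y) -> B (y, x) &
    forall x y z, B (x, y) -> B (y, z) -> A (x, z)].
Proof.
move=> /(@entourage_split_ex (symmetrization X))[B eB BA].
exists (B `&` B^-1); split.
- exact: filterI eB (sym_entourage_inv eB).
- by move=> x y [Bxy Byx]; split.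
- by move=> x y z [Bxy _] [Byz _]; apply: BA; exists y.
Qed.

Lemma qentourage_third X (A : set (X * X)) : qentourage A ->
  exists2 B, qentourage B & forall x y z t,
    B (x, y) -> B (y, z) -> B (z, t) -> A (x, t).
Proof.
move=> /qentourage_split_ex[B /[dup] eB /qentourage_split_ex[C eC CB] BA].
exists (B `&` C); first exact: (@filterI _ _ (@qentourage_filter X)).
move=> x y z t [Bxy _] [_ Cyz] [_ Czt]; apply: BA; exists y => //.
by apply: CB; exists z.
Qed.

Lemma qunif_continuous_sym X Y (f : X -> Y) : qunif_continuous f ->
  forall A, sym_entourage A ->
    sym_entourage [set xy | A (f xy.1, f xy.2)].
Proof.
pose ff (xy : X * X) := (f xy.1, f xy.2).
move=> cf; apply: (@sym_entourage_ind _ (ff @ @sym_entourage X)).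
by move=> A /cf/qentourage_sym[].
Qed.

(** The symmetrization of a T0 quasi-uniform space is Hausdorff, which is what
    makes limits in it unique. *)
Lemma sym_entourage_separated X : kolmogorov_space (qtopology X) ->
  forall x y : X, (forall A, sym_entourage A -> A (x, y)) -> x = y.
Proof.
move=> T0 x y exy; apply: contrapT => /eqP /(T0 x y)[B [|]] [].
- move=> /set_mem[A /qentourage_sym[eA _] sAB] /set_mem; apply.
  by apply: sAB; apply/mem_set; exact: exy eA.
- move=> /set_mem[A /qentourage_sym[_ eA] sAB] /set_mem; apply.
  by apply: sAB; apply/mem_set; exact: exy eA.
Qed.

(** The criterion that recognizes bicompletions: a map i into a T0 bicomplete
    space W is a bicompletion as soon as X carries the quasi-uniformity induced
    along i and the image of i is dense for the symmetrized uniformity.  As for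
    completions of uniform spaces, a map f into a T0 bicomplete space extends
    to a point p of W by taking the limit of f along the traces on X of the
    symmetric neighbourhoods of p. *)
Section Extension.
Variables (X W : quasiUniformType) (i : X -> W).
Hypothesis i_continuous : qunif_continuous i.
Hypothesis i_initial : forall U, qentourage U ->
  exists2 V, qentourage V & [set xy | V (i xy.1, i xy.2)] `<=` U.
Hypothesis i_dense : forall p V, sym_entourage V -> exists x, V (p, i x).

Lemma initial_sym U : sym_entourage U ->
  exists2 V, sym_entourage V & [set xy | V (i xy.1, i xy.2)] `<=` U.
Proof.
move: U; apply: (@sym_entourage_ind X [set U | exists2 V, sym_entourage V &
  [set xy | V (i xy.1, i xy.2)] `<=` U]).
  split=> /=.
  - by exists setT => //; exact: filterT.
  - move=> P Q [V eV VP] [V' eV' VQ]; exists (V `&` V').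
      exact: filterI eV eV'.
    by move=> xy [/VP ? /VQ].
  - by move=> P Q PQ [V eV VP]; exists V => //; exact: subset_trans PQ.
move=> U /i_initial[V /qentourage_sym[eV eVV] VU]; split; first by exists V.
by exists V^-1 => // -[x y] /= Vyx; apply: (VU (y, x)).
Qed.

Section Target.
Variables (Z : quasiUniformType) (f : X -> Z).
Hypothesis Z_T0 : kolmogorov_space (qtopology Z).
Hypothesis Z_bicomplete : bicomplete Z.
Hypothesis f_continuous : qunif_continuous f.

(** This says that z is the limit of f along the trace on X of the symmetric
    neighbourhood filter of p.  Phrased with entourages only, it makes both the
    uniqueness of z and the continuity of the extension short chases. *)
Definition extension_at p z := forall V, sym_entourage V ->
  exists2 V', sym_entourage V' & forall x, V' (p, i x) -> V (z, f x).

(** The trace filter is proper by density; it is Cauchy, and so is its image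
    under f, because the entourages of X come from those of W. *)
Lemma extension_exists p : exists z, extension_at p z.
Proof.
pose F : set_system (symmetrization Z) :=
  [set B | exists2 V, sym_entourage V & forall x, V (p, i x) -> B (f x)].
have FF : ProperFilter F.
  split; first by move=> [V /(i_dense p)[x Vx] /(_ x Vx)].
  split.
  - by exists setT => //; exact: filterT.
  - move=> P Q [V eV VP] [V' eV' VQ]; exists (V `&` V').
      exact: filterI eV eV'.
    by move=> x [/VP ? /VQ].
  - by move=> P Q PQ [V eV VP]; exists V => // x /VP /PQ.
have [V /= eV|z Fz] := Z_bicomplete FF.
  have [V1 eV1 V1V] := initial_sym (qunif_continuous_sym f_continuous eV).
  have [V2 [eV2 V2s V2V1]] := sym_entourage_half eV1.
  pose B := f @` [set x | V2 (p, i x)].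
  have FB : F B by exists V2 => // x V2x; exists x.
  exists (B, B) => // -[_ _] [/= [x V2x <-] [y V2y <-]].
  by apply: (V1V (x, y)); apply: V2V1 V2y; apply: V2s.
exists z => V eV; have [] := Fz (xsection V z).
  exact: (@nbhs_entourage (symmetrization Z)).
by move=> V' eV' V'V; exists V' => // x /V'V /set_mem.
Qed.

Lemma extension_unique p z t : extension_at p z -> extension_at p t -> z = t.
Proof.
move=> ez et; apply: (sym_entourage_separated Z_T0) => V eV.
have [V' [eV' V's V'V]] := sym_entourage_half eV.
have [A eA Az] := ez _ eV'; have [B eB Bt] := et _ eV'.
have [x [/Az Vzx /Bt Vtx]] := i_dense p (filterI eA eB).
by apply: V'V Vzx _; apply: V's.
Qed.

(** Any continuous extension satisfies the limit condition at every point, which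
    is why it is unique. *)
Lemma extension_at_comp g : qunif_continuous g -> f = g \o i ->
  forall p, extension_at p (g p).
Proof.
move=> /qunif_continuous_sym cg fgi p V /cg eV; rewrite fgi.
by exists [set xy | V (g xy.1, g xy.2)].
Qed.

Lemma unique_extension :
  exists! g : W -> Z, qunif_continuous g /\ f = g \o i.
Proof.
have [g eg] := choice extension_exists.
exists g; split; last first.
  move=> g' [cg' fg']; apply/funext => p.
  exact: extension_unique (eg p) (extension_at_comp cg' fg' p).
split; last first.
  apply/funext => x; apply: extension_unique (eg (i x)) => V.
  move=> /(qunif_continuous_sym f_continuous)/initial_sym[V' eV' V'V].
  by exists V' => // y /(V'V (x, y)).
move=> V /qentourage_third[V' eV' V'V].
have [O /qentourage_third[O' eO' O'O] OV'] := i_initial (f_continuous eV').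
apply: (@filterS _ _ (@qentourage_filter W) O' _ _ (eO')) => -[p q] O'pq /=.
have [eV's eV'i] := qentourage_sym eV'; have [eO's eO'i] := qentourage_sym eO'.
have [A eA Ap] := eg p _ eV's; have [B eB Bq] := eg q _ eV'i.
(* x and y approximate p and q; both are chosen close enough for the images
   f x and f y to approximate g p and g q from the side that the three-step
   chain needs. *)
have [x [Oxp /Ap Vpx]] := i_dense p (filterI eO'i eA).
have [y [Oqy /Bq Vyq]] := i_dense q (filterI eO's eB).
apply: V'V Vpx _ Vyq; apply: (OV' (x, y)).
exact: O'O Oxp O'pq Oqy.
Qed.

End Target.

Lemma dense_initial_is_bicompletion :
  kolmogorov_space (qtopology W) -> bicomplete W -> is_bicompletion i.
Proof. by move=> T0 bc; split=> // Z f; exact: unique_extension. Qed.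

End Extension.

Lemma qunif_continuous_continuous X Y (f : X -> Y) : qunif_continuous f ->
  continuous (f : qtopology X -> qtopology Y).
Proof.
move=> cf x A [V /cf eV VA]; exists [set xy | V (f xy.1, f xy.2)] => //.
by move=> y /set_mem Vy; apply/VA/mem_set.
Qed.

Lemma bicompletions_homeomorphic X Y Z (i : X -> Y) (j : X -> Z) :
  is_bicompletion i -> is_bicompletion j ->
  homeomorphic (qtopology Y) (qtopology Z).
Proof.
move=> [T0i bi ci ui] [T0j bj cj uj].
have [f [[cf jfi] _]] := ui _ j T0j bj cj.
have [g [[cg igj] _]] := uj _ i T0i bi ci.
have cid W : qunif_continuous (@idfun W).
  by move=> V; apply: (@filterS _ _ (@qentourage_filter W)) => -[].
have ccomp (U V W : quasiUniformType) (u : U -> V) (v : V -> W) :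
    qunif_continuous u -> qunif_continuous v -> qunif_continuous (v \o u).
  by move=> cu cv A /cv /cu.
exists f, g; split; try exact: qunif_continuous_continuous.
- have [h [_ uh]] := ui _ i T0i bi ci.
  have /(congr1 (fun k => k _)) E : g \o f = idfun.
    rewrite -(uh idfun) ?(uh (g \o f)) //; split=> //; first exact: ccomp.
    by rewrite -compA -jfi.
  by move=> p; exact: (E p).
- have [h [_ uh]] := uj _ j T0j bj cj.
  have /(congr1 (fun k => k _)) E : f \o g = idfun.
    rewrite -(uh idfun) ?(uh (f \o g)) //; split=> //; first exact: ccomp.
    by rewrite -compA -igj.
  by move=> p; exact: (E p).
Qed.

End QuasiUniform.

(** * The Stone dual as a Pervin space *)

Lemma pervin_entourage_ind (X : choiceType) (K : set_system X)
    (M : set_system (X * X)) : Filter M ->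
  (forall A, K A -> M (pervin_rel A)) -> pervin_entourage K `<=` M.
Proof. by move=> FM MA A; apply; split=> // _ [B /MA ? <-]. Qed.

Lemma pervin_entourage_rel (X : choiceType) (K : set_system X) (A : set X) :
  K A -> pervin_entourage K (pervin_rel A).
Proof. by move=> KA; apply: sub_gen_smallest; exists A. Qed.

Section StonePervin.
Variables (dD : Order.disp_t) (D : tbDistrLatticeType dD).
Implicit Types (p q : stone_dual D) (a b d : D).

(** The Stone dual space with the Pervin quasi-uniformity of its base; it is
    the concrete model of the bicompletion. *)
Definition stone_pervin : quasiUniformType := pervin (range (@stone_basic _ D)).

Lemma primeT p : sval p \top.
Proof. by case: (set_mem (svalP p)) => -[]. Qed.

Lemma prime0 p : ~ sval p \bot.
Proof. by case: (set_mem (svalP p)) => -[]. Qed.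

Lemma prime_le p a b : a <= b -> sval p a -> sval p b.
Proof. by case: (set_mem (svalP p)) => _ h _ _; exact: h. Qed.

Lemma primeI p a b : sval p a -> sval p b -> sval p (a `&` b).
Proof. by case: (set_mem (svalP p)) => _ _ h _; exact: h. Qed.

Lemma primeU p a b : sval p (a `|` b) -> sval p a \/ sval p b.
Proof. by case: (set_mem (svalP p)) => _ _ _ h; exact: h. Qed.

Lemma stone_pervin_rel d :
  @qentourage stone_pervin (pervin_rel (stone_basic d)).
Proof. by apply: pervin_entourage_rel; exists d. Qed.

(** Around p, a Pervin relation or its inverse only asks a prime filter to
    contain an element of p, or to avoid an element outside p.  Finitely many
    such conditions merge into one of each kind, because p is a prime filter. *)
Lemma stone_sym_entourage_section (V : set (stone_dual D * stone_dual D)) :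
  @sym_entourage stone_pervin V -> forall p, exists d d',
    [/\ sval p d, ~ sval p d' &
        forall q, sval q d -> ~ sval q d' -> V (p, q)].
Proof.
move=> eV p; move: V eV.
pose M := [set V : set (stone_dual D * stone_dual D) | exists d d',
  [/\ sval p d, ~ sval p d' & forall q, sval q d -> ~ sval q d' -> V (p, q)]].
have FM : Filter M.
  split.
  - by exists \top, \bot; split=> //; [exact: primeT|exact: prime0].
  - move=> P Q [a [a' [pa pa' aP]]] [b [b' [pb pb' bQ]]].
    exists (a `&` b), (a' `|` b'); split.
    + exact: primeI.
    + by move=> /primeU[].
    + move=> q qab qab'; split.
        apply: aP (prime_le (leIl _ _) qab) _.
        by apply: contra_not qab'; exact: prime_le (leUl _ _).
      apply: bQ (prime_le (leIr _ _) qab) _.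
      by apply: contra_not qab'; exact: prime_le (leUr _ _).
  - move=> P Q PQ [a [a' [pa pa' aP]]]; exists a, a'; split=> // q qa qa'.
    exact/PQ/aP.
apply: (@sym_entourage_ind stone_pervin M FM).
apply: pervin_entourage_ind.
  split.
  - by split; exact: filterT.
  - move=> P Q [MP MP'] [MQ MQ'].
    by split; [exact: filterI MP MQ|exact: filterI MP' MQ'].
  - by move=> P Q PQ [MP MP']; split;
      [apply: filterS MP|apply: filterS MP' => -[x y] /PQ].
move=> _ [d _ <-]; split.
  case: (pselect (sval p d)) => pd.
    by exists d, \bot; split=> //; [exact: prime0|move=> q qd _ _].
  exists \top, \bot.
  by split=> //; [exact: primeT|exact: prime0|move=> q _ _ /pd].
case: (pselect (sval p d)) => pd.
  exists \top, \bot.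
  by split=> //; [exact: primeT|exact: prime0|move=> q _ _ _].
by exists \top, d; split=> //; [exact: primeT|move=> q _ qd /qd].
Qed.

Lemma stone_pervin_T0 : kolmogorov_space (qtopology stone_pervin).
Proof.
have nb d p : sval p d -> nbhs (p : qtopology stone_pervin) (stone_basic d).
  move=> pd; exists (pervin_rel (stone_basic d)); first exact: stone_pervin_rel.
  by move=> q /set_mem; apply.
move=> p q /eqP pq.
have [d dpq] : exists d, ~ (sval p d <-> sval q d).
  apply/existsNP => e; apply: pq; apply: val_inj.
  by apply/funext => d; apply/propext; exact: e.
exists (stone_basic d).
case: (pselect (sval p d)) => pd; [left|right]; split; apply/mem_set.
- exact: nb.
- by move=> qd; apply: dpq; split.
- by apply: nb; apply: contrapT => qd; apply: dpq; split.
- by [].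
Qed.

(** A Cauchy filter F decides each d, in that F contains either the set of
    prime filters containing d or its complement; the elements d that it accepts
    form a prime filter, and this is the limit of F. *)
Lemma stone_pervin_bicomplete : bicomplete stone_pervin.
Proof.
move=> F FF cF.
have dec d : F (stone_basic d) \/ F [set p | ~ sval p d].
  have [eV eVi] := qentourage_sym (stone_pervin_rel d).
  have [[P Q] /= [FP FQ] PQ] :=
    cF _ (@filterI _ _ (@sym_entourage_filter stone_pervin) _ _ eV eVi).
  have FPQ : F (P `&` Q) by exact: filterI FP FQ.
  have [p [Pp Qp]] := filter_ex FPQ.
  case: (pselect (sval p d)) => pd; [left|right].
    apply: filterS FPQ => q [Pq Qq].
    by have /= [/(_ pd)] := PQ (p, q) (conj Pp Qq).
  apply: filterS FPQ => q [Pq Qq] qd; apply: pd.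
  by have /= [/(_ qd)] := PQ (q, p) (conj Pq Qp).
pose x := [set d | F (stone_basic d)].
have px : prime_filter x.
  split.
  - split; first by apply: filterS filterT => p _; exact: primeT.
    by move=> /filter_ex[p /prime0].
  - by move=> a b ab; apply: filterS => p; exact: prime_le.
  - move=> a b Fa Fb; apply: filterS (filterI Fa Fb) => p [pa pb].
    exact: primeI.
  - move=> a b Fab; apply: contrapT => /not_orP[nFa nFb].
    have [//|Fa'] := dec a; have [//|Fb'] := dec b.
    have [p [/primeU + [pa pb]]] := filter_ex (filterI Fab (filterI Fa' Fb')).
    by case.
exists (exist _ x (mem_set px)) => A.
rewrite -nbhs_entourageE => -[V eV VA].
have [d [d' [xd xd' dV]]] :=
  stone_sym_entourage_section eV (exist _ x (mem_set px)).
have [//|Fd'] := dec d'.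
by apply: filterS (filterI xd Fd') => q [qd qd']; apply/VA/mem_set/dV.
Qed.

Lemma stone_basic_open d : open (stone_basic d).
Proof.
exists [set stone_basic d]; first by move=> _ ->; exists d.
by rewrite bigcup_set1.
Qed.

Lemma stone_pervin_homeomorphic :
  homeomorphic (qtopology stone_pervin) (stone_dual D).
Proof.
exists idfun, idfun; split=> //.
- move=> p A /=; rewrite nbhsE => -[B [oB Bp] BA].
  have [d pd dB] : exists2 d, sval p d & stone_basic d `<=` B.
    case: oB Bp BA => K Kbasic <- [B' KB' B'p] _.
    have [d _ dB'] := Kbasic _ KB'; exists d => [|q qd].
      by rewrite -dB' in B'p.
    by exists B' => //; rewrite -dB'.
  exists (pervin_rel (stone_basic d)); first exact: stone_pervin_rel.
  by move=> q /set_mem/(_ pd) qd; apply/BA/dB.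
- move=> p A [V eV VA]; apply: filterS VA _.
  pose M := [set V : set (stone_dual D * stone_dual D) |
    nbhs (p : stone_dual D) (xsection V p)].
  apply: (@pervin_entourage_ind _ _ M _ _ _ eV).
    split.
    + by rewrite /M/= xsectionE; exact: filterT.
    + by move=> P Q MP MQ; rewrite /M/= xsectionI; exact: filterI.
    + by move=> P Q PQ; rewrite /M/=; apply: filterS => q /set_mem/PQ/mem_set.
  move=> _ [d _ <-]; rewrite /M/=.
  case: (pselect (sval p d)) => pd.
    rewrite nbhsE; exists (stone_basic d).
      by split=> //; exact: stone_basic_open.
    by move=> q qd; apply/mem_set.
  by apply: filterS filterT => q _; apply/mem_set => /pd.
Qed.

End StonePervin.

(** * Completely join-irreducible elements of a canonical extension *)

Section CompleteLattice.
Variables (dC : Order.disp_t) (C : tbLatticeType dC).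
Hypothesis C_complete : complete_lattice C.
Implicit Types (S : set C) (u : C).

Lemma bigjoin_supremum S : supremums S (bigjoin S).
Proof.
rewrite /bigjoin /supremum; case: ifPn => [/eqP ->|_].
  by split=> [x []//|x _]; exact: le0x.
by case: (C_complete S) => + _; exact: xgetPex.
Qed.

Lemma bigmeet_infimum S : infimums S (bigmeet S).
Proof.
rewrite /bigmeet /infimum; case: ifPn => [/eqP ->|_].
  by split=> [x []//|x _]; exact: lex1.
by case: (C_complete S) => _; exact: xgetPex.
Qed.

Lemma bigjoin_ub S u : S u -> u <= bigjoin S.
Proof. by case: (bigjoin_supremum S) => ubS _; exact: ubS. Qed.

Lemma bigjoin_le S u : (forall v, S v -> v <= u) -> bigjoin S <= u.
Proof. by case: (bigjoin_supremum S) => _ leS; exact: leS. Qed.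

Lemma bigmeet_lb S u : S u -> bigmeet S <= u.
Proof. by case: (bigmeet_infimum S) => lbS _; exact: lbS. Qed.

Lemma bigmeet_ge S u : (forall v, S v -> u <= v) -> u <= bigmeet S.
Proof. by case: (bigmeet_infimum S) => _ geS; exact: geS. Qed.

End CompleteLattice.

Section LatticeHom.
Variables (dL : Order.disp_t) (L : tbLatticeType dL).
Variables (dM : Order.disp_t) (M : tbLatticeType dM) (f : L -> M).
Hypothesis f_hom : lattice_hom f.

Lemma lattice_hom_joins (I : Type) (s : seq I) (F : I -> L) :
  f (\join_(i <- s) F i) = \join_(i <- s) f (F i).
Proof. by case: f_hom => _ fU f0 _; exact: big_morph. Qed.

Lemma lattice_hom_meets (I : Type) (s : seq I) (F : I -> L) :
  f (\meet_(i <- s) F i) = \meet_(i <- s) f (F i).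
Proof. by case: f_hom => fI _ _ f1; exact: big_morph. Qed.

Lemma lattice_hom_le a b : a <= b -> f a <= f b.
Proof. by case: f_hom => fI _ _ _ /meet_idPl ab; rewrite -ab fI leIr. Qed.

Lemma lattice_hom_leE a b : injective f -> (f a <= f b) = (a <= b).
Proof.
move=> inj; apply/idP/idP => [|/lattice_hom_le//].
by case: f_hom => fI _ _ _; rewrite !leEmeet -fI => /eqP/inj/eqP.
Qed.

End LatticeHom.

Section CanonicalExtension.
Variables (dL : Order.disp_t) (L : tbLatticeType dL).
Variables (dC : Order.disp_t) (C : tbLatticeType dC) (e : L -> C).
Hypothesis e_canonical : canonical_extension e.
Implicit Types (S T : set L) (u v x : C) (a b c : L).

Local Notation J := (@completely_join_irreducible dC C).

Let C_complete : complete_lattice C.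
Proof. by case: e_canonical. Qed.

Let e_hom : lattice_hom e.
Proof. by case: e_canonical. Qed.

Let e_inj : injective e.
Proof. by case: e_canonical. Qed.

(** In the terminology of canonical extensions these are the closed (or filter)
    and the open (or ideal) elements. *)
Definition closed_elt S : C := bigmeet (e @` S).
Definition open_elt T : C := bigjoin (e @` T).

Lemma closed_elt_le S a : S a -> closed_elt S <= e a.
Proof. by move=> Sa; apply: bigmeet_lb => //; exists a. Qed.

Lemma open_elt_ge T a : T a -> e a <= open_elt T.
Proof. by move=> Ta; apply: bigjoin_ub => //; exists a. Qed.

Lemma le_closed_elt S u : (forall a, S a -> u <= e a) -> u <= closed_elt S.
Proof. by move=> Su; apply: bigmeet_ge => // _ [a Sa <-]; exact: Su. Qed.

(** Compactness, used through its consequence that an inequality between a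
    closed and an open element already holds for a finite meet on the left. *)
Lemma closed_le_open_finite S T : closed_elt S <= open_elt T ->
  exists s : seq L, (forall a, a \in s -> S a) /\
    e (\meet_(a <- s) a) <= open_elt T.
Proof.
case: e_canonical => _ _ _ _ /(_ S T) cpt /cpt[S' [T' [S'S T'T S'T']]].
exists S'; split=> //; apply: le_trans (lattice_hom_le e_hom S'T') _.
rewrite lattice_hom_joins //; apply/joinsP_seq => t tT' _.
exact/open_elt_ge/T'T.
Qed.

Lemma closed_separation u v : ~ u <= v ->
  exists S, closed_elt S <= u /\ ~ closed_elt S <= v.
Proof.
case: e_canonical => _ _ _ /(_ u)[uE _] _ nuv; apply: contrapT => nS.
apply: nuv; rewrite uE; apply: bigjoin_le => // _ [S Su <-].
by apply: contrapT => nSv; apply: nS; exists S.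
Qed.

Lemma open_separation u v : ~ u <= v ->
  exists T, v <= open_elt T /\ ~ u <= open_elt T.
Proof.
case: e_canonical => _ _ _ /(_ v)[_ vE] _ nuv; apply: contrapT => nT.
apply: nuv; rewrite vE; apply: bigmeet_ge => // _ [T vT <-].
by apply: contrapT => nuT; apply: nT; exists T.
Qed.

Lemma join_irreducible_closed x : J x -> exists S, x = closed_elt S.
Proof.
move=> Jx; case: e_canonical => _ _ _ /(_ x)[/Jx[S _ <-] _] _.
by exists S.
Qed.

(** Closed elements are join-dense and open ones meet-dense, so some closed
    element below u is not below some open element y above v.  By compactness
    and Zorn's lemma there is a minimal closed element x, below the chosen one,
    that is not below y; this x is completely join-irreducible, since a join
    equal to x has a member that is not below y, and a closed element below this
    member but not below y must be x. *)
Lemma join_irreducible_dense u v : ~ u <= v ->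
  exists x, [/\ J x, x <= u & ~ x <= v].
Proof.
move=> /closed_separation[S0 [S0u /open_separation[T [vT S0T]]]].
(* Zorn's lemma is applied to sets of generators: maximal sets give minimal
   closed elements. *)
pose P := [set S : set L | ~ closed_elt (S0 `|` S)%classic <= open_elt T].
have [F FP Ftot|A [PA Amax]] := @Zorn_bigcup _ P.
  move=> /closed_le_open_finite[s [sF sT]].
  (* The finite set s lives over a single member of the chain, or over the empty
     set if the chain is empty. *)
  have [S [PS sS]] : exists S, (F S \/ S = set0) /\
      forall a, a \in s -> (S0 `|` S)%classic a.
    elim: s sF {sT} => [|a s IH] sF; first by exists set0; split=> //; right.
    have [b bs|S [FS sS]] := IH; first by apply: sF; rewrite inE bs orbT.
    have [S0a|[S' FS' S'a]] := sF a (mem_head _ _).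
      by exists S; split=> // b /[1!inE]/predU1P[->|/sS//]; left.
    have [SS'|S'S] : S `<=` S' \/ S' `<=` S.
      by case: FS => [FS|->]; [exact: Ftot|left; exact: sub0set].
    - exists S'; split=> [|b /[1!inE]/predU1P[->|/sS[]]];
        [by left|by right|by left|].
      by move=> /SS'; right.
    - exists S; split=> // b /[1!inE]/predU1P[->|/sS//].
      by right; exact: S'S.
  have : P S.
    case: PS => [/FP//|->]; rewrite /P/= setU0.
    exact: S0T.
  apply; apply: le_trans sT; rewrite lattice_hom_meets //.
  by apply/meetsP_seq => a /sS Sa _; exact: closed_elt_le.
set x := closed_elt (S0 `|` A)%classic in PA.
exists x; split; last first.
- by move=> xv; apply: PA; exact: le_trans vT.
- apply: le_trans S0u; apply: le_closed_elt => a S0a.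
  by apply: closed_elt_le; left.
move=> S xS.
have [s Ss sT] : exists2 s, S s & ~ s <= open_elt T.
  apply: contrapT => nS; apply: PA; rewrite -/x xS.
  apply: bigjoin_le => // s Ss; apply: contrapT => sT.
  by apply: nS; exists s.
have sx : s <= x by rewrite xS; exact: bigjoin_ub.
have [S2 [S2s S2T]] := closed_separation sT.
have S2x := le_trans S2s sx.
pose B := [set a | closed_elt S2 <= e a].
have S0AB : (S0 `|` A)%classic `<=` B.
  by move=> a S0Aa; apply: le_trans S2x _; exact: closed_elt_le.
have PB : P B.
  apply: contra_not S2T => /(le_trans _); apply.
  by apply: le_closed_elt => a [S0a|//]; apply: S0AB; left.
have BA : B `<=` A.
  apply: contrapT => nBA; apply: (Amax B _ PB); split=> // a Aa.
  by apply: S0AB; right.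
suff <- : s = x by [].
apply/le_anti; rewrite sx /=; apply: le_trans S2s.
apply: le_closed_elt => a S2a; apply: closed_elt_le; right.
by apply: BA; exact: closed_elt_le.
Qed.

(** Completely join-irreducible elements are prime with respect to admissible
    joins.  Otherwise every x /\ m with m in M is strictly below x, hence below
    the unique lower cover of x, hence below an open element y not above x.
    Compactness replaces x in these finitely many inequalities by one a in L
    above x; then admissibility gives a /\ \/ M <= y, and so x <= y. *)
Lemma join_irreducible_admissible x (M : {fset L}) : J x -> join_admissible M ->
  x <= e (\join_(m <- M) m) -> exists2 m, m \in M & x <= e m.
Proof.
move=> Jx Madm xM; apply: contrapT => nM.
have [S xS] := join_irreducible_closed Jx.
(* The join of everything strictly below x is not above x, because x would then
   be one of the elements joined. *)
pose xm := bigjoin [set u | u <= x /\ u <> x].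
have nxxm : ~ x <= xm.
  move=> xxm; have /Jx[//] : x = xm.
  by apply/le_anti; rewrite xxm /=; apply: bigjoin_le => // u [].
have [T [xmT xT]] := open_separation nxxm.
have aT m : m \in M -> exists2 a, x <= e a & e (a `&` m) <= open_elt T.
  move=> mM; have : closed_elt (S `|` [set m])%classic <= open_elt T.
    apply: le_trans xmT; apply: bigjoin_ub => //.
    have Smx : closed_elt (S `|` [set m])%classic <= x.
      by rewrite xS; apply: le_closed_elt => a Sa; apply: closed_elt_le; left.
    split=> // Smx_eq; apply: nM; exists m => //.
    by rewrite -Smx_eq; apply: closed_elt_le; right.
  move=> /closed_le_open_finite[s [sS sT]].
  exists (\meet_(a <- s | a != m) a).
    rewrite -big_filter lattice_hom_meets //; apply/meetsP_seq => a.
    rewrite mem_filter => /andP[/eqP am /sS[Sa _|//]].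
    by rewrite xS; exact: closed_elt_le.
  apply: le_trans sT; apply: lattice_hom_le => //.
  apply/meetsP_seq => a sa _; have [->|am] := eqVneq a m; first exact: leIr.
  by apply: leIxl; exact: meets_inf_seq.
have [a xa aM] : exists2 a, x <= e a &
    forall m, m \in (M : seq L) -> e (a `&` m) <= open_elt T.
  have : {subset (M : seq L) <= M} by [].
  elim: (M : seq L) => [|m s IH] sM.
    by exists \top => //; case: e_hom => _ _ _ ->; exact: lex1.
  have [m' m's|a xa aM] := IH; first by apply: sM; rewrite inE m's orbT.
  have [b xb bm] := aT m (sM _ (mem_head _ _)).
  exists (a `&` b); first by case: e_hom => -> _ _ _; rewrite lexI xa.
  move=> m' /[1!inE]/predU1P[->|/aM am'].
    apply: le_trans bm; apply: lattice_hom_le => //.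
    by rewrite leI2 // leIr.
  apply: le_trans am'; apply: lattice_hom_le => //.
  by rewrite leI2 // leIl.
apply: xT; have /le_trans : x <= e (a `&` \join_(m <- M) m).
  by case: e_hom => -> _ _ _; rewrite lexI xa.
apply; rewrite Madm lattice_hom_joins //.
by apply/joinsP_seq => m mM _; exact: aM.
Qed.

Lemma hatT : hat e \top = setT.
Proof.
apply/seteqP; split=> // x _; rewrite /hat/=.
by case: e_hom => _ _ _ ->; exact: lex1.
Qed.

Lemma hatI a b : hat e (a `&` b) = (hat e a `&` hat e b)%classic.
Proof.
case: e_hom => eI _ _ _; apply/seteqP; rewrite /hat /=.
by split=> x /=; rewrite eI lexI => /andP.
Qed.

Lemma hat_admissible (M : {fset L}) (x : set_type J) : join_admissible M ->
  hat e (\join_(m <- M) m) x -> exists2 m, m \in M & hat e m x.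
Proof. by apply: join_irreducible_admissible; exact/set_mem/(svalP x). Qed.

(** Conversely to [hat_admissible], a covering of the hat of a by finitely many
    hats always comes from an admissible join: take M to be the meets of a with
    the b in s.  Every inequality between joins and meets that is needed can be
    tested on completely join-irreducible elements, by density. *)
Lemma hat_cover a (s : seq L) :
  (forall x : set_type J, hat e a x -> exists2 b, b \in s & hat e b x) ->
  exists M : {fset L}, [/\ join_admissible M, \join_(m <- M) m = a &
    forall m, m \in M -> exists2 b, b \in s & m <= b].
Proof.
move=> acov; pose M := [fset Order.meet a b | b in s]%fset.
have Mcov c : c `&` a <= \join_(m <- M) (c `&` m).
  rewrite -(lattice_hom_leE e_hom)//; apply: contrapT.
  move=> /join_irreducible_dense[x [Jx + nx]].
  case: (e_hom) => eI _ _ _; rewrite eI lexI => /andP[xc xa].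
  have [b bs xb] := acov (exist _ x (mem_set Jx)) xa.
  apply: nx; rewrite lattice_hom_joins //.
  have abM : a `&` b \in M by apply/imfsetP; exists b.
  apply: le_trans (joins_sup_seq _ abM _) => //.
  by rewrite !eI !lexI xc xa.
have Ma : \join_(m <- M) m = a.
  apply/le_anti/andP; split.
    by apply/joinsP_seq => _ /imfsetP[b _ ->] _; exact: leIl.
  have := Mcov a; rewrite meetxx => /le_trans; apply.
  by apply/joinsP_seq => m mM _; apply: leIxr; exact: joins_sup_seq.
exists M; split=> //; last first.
  by move=> _ /imfsetP[b bs ->]; exists b => //; exact: leIr.
move=> c; rewrite Ma; apply/le_anti; rewrite Mcov /=.
apply/joinsP_seq => m mM _; rewrite leI2 // -Ma.
exact: joins_sup_seq.
Qed.

End CanonicalExtension.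

(** * The envelope as a lattice of finite unions *)

Lemma preserves_finite_meetsP (dL : Order.disp_t) (L : tbLatticeType dL)
    (dM : Order.disp_t) (M : tbLatticeType dM) (f : L -> M) :
  preserves_finite_meets f <->
  f \top = \top /\ (forall a b, f (a `&` b) = f a `&` f b).
Proof.
split=> [fI|[fT fI] s]; last exact: big_morph.
have meet0 dK (K : tbLatticeType dK) (F : L -> K) :
    \meet_(m <- (fset0 : {fset L})) F m = \top.
  by apply/le_anti; rewrite lex1; apply/meetsP_seq => x; rewrite inE.
have meet2 dK (K : tbLatticeType dK) (F : L -> K) a b :
    \meet_(m <- [fset a; b]%fset) F m = F a `&` F b.
  apply/le_anti/andP; split.
    by rewrite lexI !meets_inf_seq // !inE eqxx ?orbT.
  by apply/meetsP_seq => x /[1!inE]/orP[]/[1!inE]/eqP -> _; rewrite ?leIl ?leIr.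
split=> [|a b]; first by have := fI fset0; rewrite !meet0.
by have := fI [fset a; b]%fset; rewrite !meet2.
Qed.

Section FiniteUnions.
Variables (dL : Order.disp_t) (L : tbLatticeType dL) (X : choiceType).
Variable h : L -> set X.

Definition union_of (s : seq L) : set X := [set x | exists2 a, a \in s & h a x].

Definition finite_unions : {pred set X} :=
  [pred A | `[< exists s, A = union_of s >]].

Lemma union_of_finite s : union_of s \in finite_unions.
Proof. by apply/asboolP; exists s. Qed.

(** The two proofs are parameters so that the lattice structure below, whose
    closure under intersections and whose top element depend on them, can be
    attached to the type. *)
Definition union_lattice of h \top = setT &
    (forall a b, h (a `&` b) = (h a `&` h b)%classic) : Type :=
  {A : set X | A \in finite_unions}.

Hypothesis hT : h \top = setT.
Hypothesis hI : forall a b, h (a `&` b) = (h a `&` h b)%classic.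
Local Notation E := (union_lattice hT hI).

Lemma finite_unionsI : meet_closed finite_unions.
Proof.
move=> _ _ /asboolP[s ->] /asboolP[t ->].
apply/asboolP; exists [seq Order.meet a b | a <- s, b <- t].
apply/seteqP; split=> x.
  move=> [[a sa ax] [b tb bx]]; exists (a `&` b); first exact: allpairs_f.
  by rewrite hI.
move=> [_ /allpairsP[[a b] /= [sa tb ->]]]; rewrite hI => -[ax bx].
by split; [exists a|exists b].
Qed.

Lemma finite_unionsU : join_closed finite_unions.
Proof.
move=> _ _ /asboolP[s ->] /asboolP[t ->].
apply/asboolP; exists (s ++ t); apply/seteqP; split=> x.
  by move=> [][a sa ax]; exists a => //; rewrite mem_cat sa ?orbT.
move=> [a /[1!mem_cat]/orP[sa|ta] ax]; by [left; exists a|right; exists a].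
Qed.

Lemma finite_unions0 : \bot \in finite_unions.
Proof. by apply/asboolP; exists [::]; apply/seteqP; split=> // x []. Qed.

Lemma finite_unionsT : \top \in finite_unions.
Proof.
apply/asboolP; exists [:: \top]; apply/seteqP; split=> // x _.
by exists \top; rewrite ?hT // inE.
Qed.

Fact union_display : Order.disp_t. Proof. exact: Order.Disp tt tt. Qed.

HB.instance Definition _ := SubChoice.on E.
HB.instance Definition _ := Order.SubChoice_isTBSubLattice.Build
  set_display (set X) finite_unions union_display E
  finite_unionsI finite_unionsU finite_unions0 finite_unionsT.

Fact union_lattice_meetUl : @left_distributive E E Order.meet Order.join.
Proof.
move=> A B C; apply: val_inj; exact: (@meetUl _ (set X)).
Qed.

HB.instance Definition _ :=
  Order.Lattice_Meet_isDistrLattice.Build union_display E union_lattice_meetUl.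

Lemma union_lattice_leP (A B : E) : (A <= B) = (sval A `<=` sval B) :> Prop.
Proof. by rewrite -subsetEset. Qed.

(** If h turns admissible joins into unions, and every finite covering of h a
    arises from an admissible join, then the lattice of finite unions of the
    sets h a has the universal property of the envelope.  What is needed of
    this is that the canonical homomorphism from an envelope D to it is
    injective, and this is seen by constructing a homomorphism back. *)
Section Envelope.
Hypothesis h_admissible : forall (M : {fset L}) x, join_admissible M ->
  h (\join_(m <- M) m) x -> exists2 m, m \in M & h m x.
Hypothesis h_cover : forall a (s : seq L),
  (forall x, h a x -> exists2 b, b \in s & h b x) ->
  exists M : {fset L}, [/\ join_admissible M, \join_(m <- M) m = a &
    forall m, m \in M -> exists2 b, b \in s & m <= b].

Lemma union_of1 a : h a = union_of [:: a].
Proof.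
apply/seteqP; split=> [x ax|x [b /[1!inE]/eqP ->]//].
by exists a; rewrite ?inE.
Qed.

Fact unions_single a : h a \in finite_unions.
Proof. by rewrite union_of1; exact: union_of_finite. Qed.

Definition unions_single_elt (a : L) : E := exist _ (h a) (unions_single a).

Lemma single_elt_meets : preserves_finite_meets unions_single_elt.
Proof.
apply/preserves_finite_meetsP.
by split=> [|a b]; apply: val_inj; [exact: hT|exact: hI].
Qed.

Lemma single_elt_joins : preserves_admissible_joins unions_single_elt.
Proof.
have single_le a b : a <= b -> unions_single_elt a <= unions_single_elt b.
  by move=> /meet_idPl <-; rewrite union_lattice_leP /= hI; exact: subIsetr.
move=> M Madm; apply/le_anti/andP; split; last first.
  by apply/joinsP_seq => m mM _; apply/single_le/joins_sup_seq.
rewrite union_lattice_leP => x /(h_admissible Madm)[m mM mx].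
have : unions_single_elt m <= \join_(m <- M) unions_single_elt m.
  exact: joins_sup_seq.
by rewrite union_lattice_leP; apply.
Qed.

Section Retraction.
Variables (dD : Order.disp_t) (D : tbDistrLatticeType dD) (eta : L -> D).
Hypothesis eta_meets : preserves_finite_meets eta.
Hypothesis eta_joins : preserves_admissible_joins eta.

Lemma eta_le a b : a <= b -> eta a <= eta b.
Proof.
have [_ etaI] := (preserves_finite_meetsP eta).1 eta_meets.
by move=> /meet_idPl <-; rewrite etaI leIr.
Qed.

(** The covering arises from an admissible join, which eta preserves.  This
    inequality makes the value of the retraction below independent of the
    chosen presentation as a finite union. *)
Lemma cover_le a (s : seq L) :
  h a `<=` union_of s -> eta a <= \join_(b <- s) eta b.
Proof.
move=> /h_cover[M [/eta_joins Meta <- Ms]].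
rewrite Meta; apply/joinsP_seq => m /Ms[b bs mb] _.
by apply: le_trans (eta_le mb) _; exact: joins_sup_seq.
Qed.

Definition representatives (A : E) : seq L :=
  sval (cid (asboolP _ (svalP A))).

Lemma representativesE (A : E) : sval A = union_of (representatives A).
Proof. by rewrite /representatives; case: cid. Qed.

Definition retraction (A : E) : D := \join_(a <- representatives A) eta a.

Lemma retraction_le (A : E) (s : seq L) : sval A `<=` union_of s ->
  retraction A <= \join_(b <- s) eta b.
Proof.
rewrite representativesE => As; apply/joinsP_seq => a aA _.
by apply: cover_le => x ax; apply: As; exists a.
Qed.

Lemma retractionE (A : E) (s : seq L) : sval A = union_of s ->
  retraction A = \join_(b <- s) eta b.
Proof.
move=> As; apply/le_anti; rewrite retraction_le ?As //=.
apply/joinsP_seq => a sa _; apply: cover_le => x ax.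
by rewrite -representativesE As; exists a.
Qed.

Lemma retraction_single a : retraction (unions_single_elt a) = eta a.
Proof. by rewrite (@retractionE _ [:: a]) ?big_seq1 //; exact: union_of1. Qed.

Lemma retraction_homo (A B : E) : A <= B -> retraction A <= retraction B.
Proof.
by rewrite union_lattice_leP (representativesE B) => /retraction_le.
Qed.

Lemma retraction_hom : lattice_hom retraction.
Proof.
have [etaT etaI] := (preserves_finite_meetsP eta).1 eta_meets.
split.
- move=> A B; apply/le_anti; rewrite lexI !retraction_homo ?leIl ?leIr //=.
  have meet_joinsl (u : D) (s : seq L) :
      (\join_(a <- s) eta a) `&` u = \join_(a <- s) (eta a `&` u).
    by apply: (big_morph (fun v => v `&` u)) => [v w|]; rewrite ?meetUl ?meet0x.
  rewrite /(retraction A) meet_joinsl; apply/joinsP_seq => a aA _.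
  rewrite /(retraction B) meetC meet_joinsl; apply/joinsP_seq => b bB _.
  rewrite -etaI -retraction_single retraction_homo // union_lattice_leP /=.
  rewrite hI (representativesE A) (representativesE B).
  by move=> x [bx ax]; split; [exists a|exists b].
- move=> A B; apply/le_anti.
  rewrite leUx !retraction_homo ?leUl ?leUr ?andbT //=.
  rewrite -big_cat; apply: retraction_le => x.
  rewrite /= (representativesE A) (representativesE B).
  by move=> [][a sa ax]; exists a => //; rewrite mem_cat sa ?orbT.
- apply/le_anti; rewrite le0x andbT.
  have -> : \bot = \join_(a <- [::]) eta a by rewrite big_nil.
  exact: retraction_le.
- apply/le_anti; rewrite lex1 /= -etaT -retraction_single.
  by rewrite retraction_homo // lex1.
Qed.

End Retraction.

(** The composite of the map g given by the universal property with the
    retraction fixes the image of eta, hence is the identity of D by the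
    uniqueness part of the universal property. *)
Lemma envelope_representation dD (D : tbDistrLatticeType dD) (eta : L -> D) :
  wedge_envelope eta -> exists g : D -> E,
    [/\ lattice_hom g, forall a, sval (g (eta a)) = h a & injective g].
Proof.
move=> [_ eta_meets eta_joins eta_univ].
have [g [[g_hom gE] _]] := eta_univ _ E _ single_elt_meets single_elt_joins.
have gEa a : g (eta a) = unions_single_elt a by rewrite gE.
exists g; split=> [//|a|]; first by rewrite gEa.
have [k [_ k_unique]] := eta_univ _ D eta eta_meets eta_joins.
apply: (can_inj (g := retraction eta)) => d.
have kE : k = retraction eta \o g.
  apply: k_unique; split; last first.
    by apply/funext => a; rewrite /= gEa retraction_single.
  have [rI rU r0 r1] := retraction_hom eta_meets eta_joins.
  have [gI gU g0 g1] := g_hom.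
  by split=> [b c|b c||] /=; rewrite ?gI ?gU ?g0 ?g1 ?rI ?rU ?r0 ?r1.
by rewrite -[LHS]/((retraction eta \o g) d) -kE (k_unique id).
Qed.

End Envelope.

End FiniteUnions.

(** * The bicompletion *)

Section PervinBicompletion.
Variables (dL : Order.disp_t) (L : tbLatticeType dL) (X : choiceType).
Variable h : L -> set X.
Hypothesis hT : h \top = setT.
Hypothesis hI : forall a b, h (a `&` b) = (h a `&` h b)%classic.

Local Notation E := (union_lattice hT hI).
Local Notation PX := (pervin (range h)).

Lemma pervin_rel_union_of (s : seq L) :
  pervin_entourage (range h) (pervin_rel (union_of h s)).
Proof.
have Fent : Filter (pervin_entourage (range h)).
  exact: smallest_filter_filter.
elim: s => [|a s IH].
  by apply: (@filterS _ _ Fent setT) => [[x y] _ []//|]; exact: filterT.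
have ha : pervin_entourage (range h) (pervin_rel (h a)).
  by apply: pervin_entourage_rel; exists a.
apply: (@filterS _ _ Fent _ _ _ (filterI ha IH)) => -[x y] [hxy sxy].
move=> [b /[1!inE]/predU1P[->|bs] bx].
  by exists a; [rewrite inE eqxx|exact: hxy].
have [|c cs cy] := sxy; first by exists b.
by exists c => //; rewrite inE cs orbT.
Qed.

(** The data are those of [envelope_representation]: D is identified by g with
    the lattice of finite unions of the sets h a, and a point x of X is sent to
    the prime filter of the unions that contain it. *)
Variables (dD : Order.disp_t) (D : tbDistrLatticeType dD) (eta : L -> D).
Variable g : D -> E.
Hypothesis g_hom : lattice_hom g.
Hypothesis g_eta : forall a, sval (g (eta a)) = h a.
Hypothesis g_inj : injective g.

Lemma point_prime_filter x : prime_filter [set d | sval (g d) x].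
Proof.
have [gI gU g0 gT] := g_hom; split=> [|a b ab|a b|a b] /=.
- by split; rewrite ?gT ?g0.
- have : g a <= g b by exact: lattice_hom_le.
  by rewrite union_lattice_leP; apply.
- by rewrite gI.
- by rewrite gU.
Qed.

Definition point_filter (x : PX) : stone_pervin D :=
  exist (fun p : set D => p \in @prime_filter dD D) _
    (mem_set (point_prime_filter x)).

(** The points whose prime filter contains d form a finite union of sets h a,
    and the Pervin relation of such a union is an entourage. *)
Lemma point_filter_continuous : qunif_continuous point_filter.
Proof.
pose ff (xy : PX * PX) := (point_filter xy.1, point_filter xy.2).
have Fent : Filter (@qentourage PX) by exact: qentourage_filter.
apply: (@pervin_entourage_ind _ _ (ff @ @qentourage PX)) => _ [d _ <-].
have /asboolP[s gds] := svalP (g d).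
suff : qentourage (pervin_rel (sval (g d)) : set (PX * PX)) by [].
by rewrite gds; exact: pervin_rel_union_of.
Qed.

Lemma point_filter_initial (U : set (PX * PX)) : qentourage U ->
  exists2 V, qentourage V &
    [set xy | V (point_filter xy.1, point_filter xy.2)] `<=` U.
Proof.
have Fent : Filter (@qentourage (stone_pervin D)) by exact: qentourage_filter.
move: U; apply: (@pervin_entourage_ind _ _ [set U : set (PX * PX) |
    exists2 V, qentourage V &
    [set xy | V (point_filter xy.1, point_filter xy.2)] `<=` U]).
  split=> /=.
  - by exists setT => //; exact: filterT.
  - move=> P Q [V eV VP] [V' eV' VQ]; exists (V `&` V').
      exact: filterI eV eV'.
    by move=> xy [/VP ? /VQ].
  - by move=> P Q PQ [V eV VP]; exists V => //; exact: subset_trans PQ.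
move=> _ [a _ <-]; exists (pervin_rel (@stone_basic _ D (eta a))).
  exact: stone_pervin_rel.
by move=> [x y]; rewrite /pervin_rel/stone_basic/= g_eta.
Qed.

(** Injectivity of g is density: d in p and d' outside p are not in the order
    d <= d', so some point lies in the set of d and not in the set of d'. *)
Lemma point_filter_dense (p : stone_pervin D) V : sym_entourage V ->
  exists x, V (p, point_filter x).
Proof.
move=> /stone_sym_entourage_section/(_ p)[d [d' [pd pd' dV]]].
have [x dx d'x] : exists2 x, sval (g d) x & ~ sval (g d') x.
  apply: contrapT => ndd'; apply: pd'; apply: prime_le pd.
  rewrite -(lattice_hom_leE g_hom) // union_lattice_leP => x dx.
  by apply: contrapT => d'x; apply: ndd'; exists x.
by exists x; exact: dV.
Qed.

Lemma point_filter_bicompletion : is_bicompletion point_filter.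
Proof.
apply: dense_initial_is_bicompletion.
- exact: point_filter_continuous.
- exact: point_filter_initial.
- exact: point_filter_dense.
- exact: stone_pervin_T0.
- exact: stone_pervin_bicomplete.
Qed.

End PervinBicompletion.

Lemma homeomorphic_trans (S T U : topologicalType) :
  homeomorphic S T -> homeomorphic T U -> homeomorphic S U.
Proof.
move=> [f [f' [ff' f'f cf cf']]] [k [k' [kk' k'k ck ck']]].
exists (k \o f), (f' \o k'); split; try exact: can_comp.
- by move=> x; apply: continuous_comp; [exact: cf|exact: ck].
- by move=> x; apply: continuous_comp; [exact: ck'|exact: cf'].
Qed.

Lemma hat_pervin_bicompletion (dL : Order.disp_t) (L : tbLatticeType dL)
    (dC : Order.disp_t) (C : tbLatticeType dC) (e : L -> C)
    (dD : Order.disp_t) (D : tbDistrLatticeType dD) (eta : L -> D) :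
  canonical_extension e -> wedge_envelope eta ->
  bicompletion_homeomorphic_to (hat_pervin e) (stone_dual D).
Proof.
move=> he eta_env.
have [g [g_hom g_eta g_inj]] := envelope_representation (hatT he) (hatI he)
  (hat_admissible he) (hat_cover he) eta_env.
have i_bic := point_filter_bicompletion g_hom g_eta g_inj.
split; first by exists (stone_pervin D), (point_filter g_hom).
move=> Xt j j_bic.
apply: homeomorphic_trans (stone_pervin_homeomorphic D).
exact: bicompletions_homeomorphic j_bic i_bic.
Qed.

Lemma canonical_extension_dual (dL : Order.disp_t) (L : tbLatticeType dL)
    (dC : Order.disp_t) (C : tbLatticeType dC) (e : L -> C) :
  canonical_extension e -> @canonical_extension _ L^d%type _ C^d%type e.
Proof.
case=> cC [eI eU e0 e1] inj dense cpt; split=> //.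
- by move=> S; have [] := cC S.
- by move=> u; have [] := dense u.
- by move=> S T /cpt[S' [T' [? ? ?]]]; exists T', S'.
Qed.

Theorem theorem5p3 (dL : Order.disp_t) (L : tbLatticeType dL)
    (dC : Order.disp_t) (C : tbLatticeType dC) (e : L -> C)
    (he : canonical_extension e) :
  (forall (dD : Order.disp_t) (D : tbDistrLatticeType dD) (eta : L -> D),
     wedge_envelope eta ->
     bicompletion_homeomorphic_to (hat_pervin e) (stone_dual D)) /\
  (forall (dD : Order.disp_t) (D : tbDistrLatticeType dD) (eta : L -> D),
     vee_envelope eta ->
     bicompletion_homeomorphic_to (check_pervin e) (stone_dual (D^d)%type)).
Proof.
split=> dD D eta; first exact: hat_pervin_bicompletion.
(* Completely meet-irreducible elements of C, and the sets [check e a], are by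
   computation the join-irreducible ones and the hats for the dual lattices. *)
exact: hat_pervin_bicompletion (canonical_extension_dual he).
Qed.
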